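(* Let $G=(V,E)$ be a finite simple graph of order $n=|V|\geq 2$ and let $t\geq 1$ be an integer. For each integer $k$ let $V_k=\{v\in V:\ \deg_G(v)=k\}$ (so $V_k=\emptyset$ unless $\delta(G)\leq k\leq \Delta(G)$). Then, for each integer $k$ with $\delta(S(G,t))\leq k\leq \Delta(S(G,t))$, the number of vertices of degree $k$ in the generalized Sierpiński graph $S(G,t)$ is $$|V_k|\, n^{t-1} - \frac{n^{t-1}-1}{n-1}\,\big(k\,|V_k| - (k-1)\,|V_{k-1}|\big).$$
   Context: All graphs are finite and simple. $\deg_G(v)$ is the degree of $v$ in $G$, and $\delta(G)$, $\Delta(G)$ are the minimum and maximum degree of $G$. Generalized Sierpiński graph: let $G=(V,E)$ be a graph of order $n\geq 2$ and $t$ a positive integer. Let $V^t$ be the set of words ${\bf u}=u_1u_2\ldots u_t$ of length $t$ on the alphabet $V$. The generalized Sierpiński graph of $G$ of dimension $t$, denoted $S(G,t)$, is the graph with vertex set $V^t$ in which $\{{\bf u},{\bf v}\}$ is an edge if and only if there exists $i\in\{1,\ldots,t\}$ such that: (i) $u_j=v_j$ for all $j<i$; (ii) $u_i\neq v_i$ and $\{u_i,v_i\}\in E(G)$; (iii) $u_j=v_i$ and $v_j=u_i$ for all $j>i$. *)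

(* Defs.v *)
From mathcomp Require Import all_boot all_order all_algebra.

Set Implicit Arguments.
Unset Strict Implicit.
Unset Printing Implicit Defensive.

Record sgraph := SGraph {
  vertex :> finType;
  adj : rel vertex;
  adj_sym : symmetric adj;
  adj_irrefl : irreflexive adj
}.

Definition deg (G : sgraph) (v : G) : nat := #|[set w : G | adj v w]|.

(* The default value #|G| is an upper bound of all degrees, so it only
   matters for the graph without vertices. *)
Definition min_deg (G : sgraph) : nat := \big[minn/#|G|]_(v : G) deg v.

Definition max_deg (G : sgraph) : nat := \max_(v : G) deg v.

(* The degree is an arbitrary integer, so that the class of degree k - 1 is
   empty when k = 0. *)
Definition deg_class (G : sgraph) (k : int) : {set G} :=
  [set v : G | Posz (deg v) == k].

Section Sierpinski.
Variables (G : sgraph) (t : nat).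

Definition sierpinski_adj : rel (t.-tuple G) := fun u v =>
  [exists i : 'I_t,
    [&& [forall j : 'I_t, (j < i) ==> (tnth u j == tnth v j)],
        tnth u i != tnth v i,
        adj (tnth u i) (tnth v i) &
        [forall j : 'I_t, (i < j) ==>
           (tnth u j == tnth v i) && (tnth v j == tnth u i)]]].

Lemma sierpinski_adj_sym : symmetric sierpinski_adj.
Proof.
move=> u v; apply: eq_existsb => i.
rewrite (adj_sym (tnth u i)) (eq_sym (tnth u i)).
congr [&& _, _, _ & _]; apply: eq_forallb => j.
  by rewrite (eq_sym (tnth u j)).
by rewrite andbC.
Qed.

Lemma sierpinski_adj_irrefl : irreflexive sierpinski_adj.
Proof.
move=> u; apply/existsP => -[i /and4P[_ neq_ui _ _]].
by rewrite eqxx in neq_ui.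
Qed.

Definition sierpinski : sgraph :=
  SGraph sierpinski_adj_sym sierpinski_adj_irrefl.

End Sierpinski.

(* Main.v *)
Require Import Defs.
From mathcomp Require Import all_boot all_order all_algebra.

Import Order.TTheory GRing.Theory Num.Theory.
Local Open Scope ring_scope.

(** The count is obtained by peeling off the first letter of words.  Write
    A_t(k) for the number of vertices of degree k in S(G,t), n for the order
    of G and y^t for the constant word y...y.

    S(G,t+1) consists of n copies of S(G,t), one for each first letter, and of
    one further edge between x y^t and y x^t for each edge xy of G
    ([sierpinski_adj_cons]).  So the degree of xu in S(G,t+1) is that of u in
    S(G,t), plus one if u = y^t with y adjacent to x
    ([deg_sierpinski_cons]).  In particular, since y is not adjacent to
    itself, y^t has degree deg y for every t >= 1
    ([deg_sierpinski_nseq]).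

    Hence, for t >= 1, passing from S(G,t) to S(G,t+1) multiplies every
    degree class by n, except that for each y the deg y words x y^t with x
    adjacent to y have degree deg y + 1 instead of deg y.  They leave the
    class of degree deg y and enter the next one, which gives
      A_(t+1)(k) = n A_t(k) - (k |V_k| - (k-1) |V_(k-1)|)
    ([card_deg_class_sierpinskiS]).  With A_1(k) = |V_k|, this linear
    recurrence is solved by a geometric sum
    ([card_deg_class_sierpinski]). *)

Lemma forall_ord_recl n (P : pred 'I_n.+1) :
  [forall i, P i] = P ord0 && [forall i, P (lift ord0 i)].
Proof.
apply/forallP/andP => [Pi | [P0 /forallP PS] i].
  by split; last by apply/forallP=> i.
by case: (unliftP ord0 i) => [j|] ->.
Qed.

Lemma exists_ord_recl n (P : pred 'I_n.+1) :
  [exists i, P i] = P ord0 || [exists i, P (lift ord0 i)].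
Proof.
apply/existsP/orP => [[i] | [P0 | /existsP[i Pi]]]; last 2 first.
- by exists ord0.
- by exists (lift ord0 i).
case: (unliftP ord0 i) => [j|] -> Pi; last by left.
by right; apply/existsP; exists j.
Qed.

Lemma big_tuple_cons (R : Type) (idx : R) (op : Monoid.com_law idx)
    (T : finType) n (F : n.+1.-tuple T -> R) :
  \big[op/idx]_w F w =
    \big[op/idx]_x \big[op/idx]_(u : n.-tuple T) F [tuple of x :: u].
Proof.
rewrite pair_big /=.
rewrite (reindex (fun p : T * n.-tuple T => [tuple of p.1 :: p.2])) //=.
exists (fun w : n.+1.-tuple T => (thead w, [tuple of behead w])).
  by case=> x u _; rewrite theadE; congr pair; apply: val_inj.
by move=> w _; rewrite /= -tuple_eta.
Qed.

Lemma tuple_eq_nseq (T : eqType) n (u : n.-tuple T) y :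
  [forall j, tnth u j == y] = (u == [tuple of nseq n y]).
Proof.
apply/forallP/eqP => [uy | -> j]; last by rewrite tnth_nseq.
by apply: eq_from_tnth => j; rewrite tnth_nseq; apply/eqP.
Qed.

Lemma degE (G : sgraph) (v : G) : deg v = (\sum_w adj v w)%N.
Proof. by rewrite /deg -sum1dep_card big_mkcond. Qed.

(** This splits the position i at which two adjacent words first differ: i is
    the first letter in the second alternative, a later one in the first. *)
Lemma sierpinski_adj_cons (G : sgraph) t (x y : G) (u v : t.-tuple G) :
  @adj (sierpinski G t.+1) [tuple of x :: u] [tuple of y :: v] =
    [|| (x == y) && @adj (sierpinski G t) u v |
        [&& adj x y, u == [tuple of nseq t y] & v == [tuple of nseq t x]]].
Proof.
rewrite /= /sierpinski_adj exists_ord_recl orbC; congr (_ || _).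
  case: (eqVneq x y) => [<- | neq_xy] /=; last first.
    apply/existsP=> -[i /and4P[/forallP/(_ ord0)]].
    by rewrite !tnth0 (negPf neq_xy).
  apply: eq_existsb => i; rewrite !forall_ord_recl !tnth0 !tnthS eqxx /=.
  by congr [&& _, _, _ & _]; apply: eq_forallb => j; rewrite !tnthS.
rewrite !tnth0 -!tuple_eq_nseq.
have -> : [forall j : 'I_t.+1, (j < @ord0 t)%N ==>
    (tnth [tuple of x :: u] j == tnth [tuple of y :: v] j)].
  by apply/forallP.
case: (eqVneq x y) => [<- | neq_xy] /=; first by rewrite adj_irrefl.
congr (_ && _); rewrite forall_ord_recl /=.
apply/forallP/andP => [uv | [/forallP uy /forallP vx] j].
  by split; apply/forallP=> j; move: (uv j); rewrite !tnthS => /andP[].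
by rewrite !tnthS uy vx.
Qed.

(** The last sum is 0 or 1 when t > 0.  For t = 0 every neighbour y of x
    contributes, because all constant words are then the empty one; the sum is
    deg x, so that the identity also describes the passage from the one-vertex
    graph S(G,0) to S(G,1) = G. *)
Lemma deg_sierpinski_cons (G : sgraph) t (x : G) (u : t.-tuple G) :
  @deg (sierpinski G t.+1) [tuple of x :: u] =
    (@deg (sierpinski G t) u
     + \sum_y (adj x y && (u == [tuple of nseq t y])))%N.
Proof.
rewrite !degE big_tuple_cons.
pose loc y (v : t.-tuple G) : nat := (x == y) && @adj (sierpinski G t) u v.
pose brd y (v : t.-tuple G) : nat :=
  [&& adj x y, u == [tuple of nseq t y] & v == [tuple of nseq t x]].
(* The two kinds of neighbours are disjoint since adj is irreflexive, so the
   boolean disjunction becomes a sum. *)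
transitivity (\sum_y (\sum_v loc y v + \sum_v brd y v))%N.
  apply: eq_bigr => y _; rewrite -big_split /=; apply: eq_bigr => v _.
  rewrite (congr1 nat_of_bool (sierpinski_adj_cons _ _ _ _ _ _)) /loc /brd.
  by case: (eqVneq x y) => [<-|_]; rewrite ?adj_irrefl /= ?orbF ?addn0.
rewrite big_split /=; congr (_ + _)%N.
  rewrite (bigD1 x) //= [X in (_ + X)%N]big1 => [|y].
    by rewrite addn0; apply: eq_bigr => v _; rewrite /loc eqxx.
  by rewrite eq_sym /loc => /negPf ne; rewrite big1 // => v _; rewrite ne.
apply: eq_bigr => y _; rewrite (bigD1 [tuple of nseq t x]) //=.
rewrite [X in (_ + X)%N]big1 => [|v].
  by rewrite addn0 /brd eqxx andbT.
by rewrite /brd => /negPf ->; rewrite !andbF.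
Qed.

Lemma nseq_tuple_inj (T : eqType) t (y z : T) :
  ([tuple of nseq t.+1 y] == [tuple of nseq t.+1 z]) = (y == z).
Proof. by apply/eqP/eqP => [[]|->]. Qed.

Lemma nseq_tupleS (T : Type) t (y : T) :
  [tuple of nseq t.+1 y] = [tuple of y :: [tuple of nseq t y]].
Proof. exact: val_inj. Qed.

(** The extra edge at a word x y^t needs x adjacent to y, hence x != y, so a
    constant word never gains one; only the step from S(G,0) to S(G,1)
    contributes, with deg y. *)
Lemma deg_sierpinski_nseq (G : sgraph) t (y : G) :
  @deg (sierpinski G t.+1) [tuple of nseq t.+1 y] = deg y.
Proof.
elim: t => [|t IHt]; rewrite nseq_tupleS deg_sierpinski_cons.
  rewrite [deg y]degE [X in (X + _)%N]degE big1 ?add0n => [|v _].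
    by apply: eq_bigr => z _; rewrite [X in _ && X](_ : _ = true) ?andbT.
  by rewrite (_ : v = [tuple of nseq 0 y]) ?adj_irrefl // tuple0 [RHS]tuple0.
rewrite IHt big1 ?addn0 // => z _.
by rewrite nseq_tuple_inj; case: eqP => [<-|]; rewrite ?adj_irrefl ?andbF.
Qed.

Lemma card_deg_class (G : sgraph) k :
  #|deg_class G k|%:Z = \sum_(v : G) (Posz (deg v) == k)%:Z.
Proof.
rewrite /deg_class -sum1dep_card -[Posz _]natz natr_sum big_mkcond.
by apply: eq_bigr => v _; case: ifP.
Qed.

Lemma sum_deg_class (G : sgraph) (k : int) :
  \sum_(v : G) Posz (deg v) * (Posz (deg v) == k)%:Z = k * #|deg_class G k|%:Z.
Proof.
rewrite card_deg_class mulr_sumr; apply: eq_bigr => v _.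
by case: eqP => [->|]; rewrite ?mulr0.
Qed.

(** A nonempty word is constant in at most one letter. *)
Lemma sum_adj_nseq (G : sgraph) t (x : G) (u : t.+1.-tuple G) :
  (\sum_y (adj x y && (u == [tuple of nseq t.+1 y])))%N =
    [exists y, adj x y && (u == [tuple of nseq t.+1 y])].
Proof.
case: existsP => [[y /andP[xy /eqP->]] | no_y].
  rewrite (bigD1 y) //= xy eqxx [X in (_ + X)%N]big1 ?addn0 // => z.
  by rewrite nseq_tuple_inj eq_sym => /negPf ->; rewrite andbF.
rewrite big1 // => y _; apply/eqP; rewrite eqb0; apply/negP => yP.
by case: no_y; exists y.
Qed.

(** Only the words x y^(t+1) with x adjacent to y change degree when x is
    prefixed, and for each y there are deg y of them, so summing the change
    over y gives the two weighted counts of [sum_deg_class]. *)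
Lemma card_deg_class_sierpinskiS (G : sgraph) t (k : int) :
  #|deg_class (sierpinski G t.+2) k|%:Z =
    #|G|%:Z * #|deg_class (sierpinski G t.+1) k|%:Z
    - (k * #|deg_class G k|%:Z - (k - 1) * #|deg_class G (k - 1)|%:Z).
Proof.
pose ind (d : nat) (l : int) : int := (Posz d == l)%:Z.
pose d (u : t.+1.-tuple G) := @deg (sierpinski G t.+1) u.
pose c (y : G) : t.+1.-tuple G := [tuple of nseq t.+1 y].
(* What u adds to the number of words of degree k when its degree, d u, is
   replaced by d u + 1. *)
pose gain u := ind (d u) (k - 1) - ind (d u) k.
rewrite !(card_deg_class (sierpinski _ _)) big_tuple_cons.
transitivity (\sum_(x : G) \sum_(u : t.+1.-tuple G)
    (ind (d u) k + \sum_y (adj x y && (u == c y))%:Z * gain u)).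
  apply: eq_bigr => x _; apply: eq_bigr => u _.
  rewrite -[X in _ = _ + X]mulr_suml.
  have -> : \sum_y (adj x y && (u == c y))%:Z =
            (\sum_y (adj x y && (u == c y)))%N%:Z.
    by rewrite -[RHS]natz natr_sum; apply: eq_bigr => y _; rewrite natz.
  rewrite (congr1 Posz (deg_sierpinski_cons _ _ x u)) sum_adj_nseq -/(d u).
  rewrite /gain /ind; case: [exists y, _]; last by rewrite addn0 mul0r addr0.
  rewrite mul1r addrC subrK; congr (nat_of_bool _)%:Z.
  by rewrite PoszD [RHS]eq_sym subr_eq eq_sym.
under eq_bigr do rewrite big_split.
rewrite big_split /= sumr_const -mulr_natl natz; congr (_ + _).
(* Summing over y outermost makes the condition u == c y eliminate u. *)
under eq_bigr do rewrite exchange_big.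
rewrite exchange_big /= opprB -!sum_deg_class -sumrB; apply: eq_bigr => y _.
rewrite -mulrBr.
transitivity (\sum_x (adj x y)%:Z * gain (c y)).
  apply: eq_bigr => x _; rewrite (bigD1 (c y)) //= eqxx andbT.
  rewrite big1 ?addr0 // => u /negPf ->.
  by rewrite andbF mul0r.
rewrite -mulr_suml; congr (_ * _); last by rewrite /gain /d deg_sierpinski_nseq.
rewrite degE -[RHS]natz natr_sum; apply: eq_bigr => x _.
by rewrite adj_sym natz.
Qed.

Lemma card_deg_class_sierpinski (G : sgraph) t (k : int) :
  #|deg_class (sierpinski G t.+1) k|%:Z =
    #|deg_class G k|%:Z * #|G|%:Z ^+ t
    - (\sum_(i < t) #|G|%:Z ^+ i)
      * (k * #|deg_class G k|%:Z - (k - 1) * #|deg_class G (k - 1)|%:Z).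
Proof.
elim: t => [|t IHt].
  rewrite big_ord0 mul0r subr0 mulr1 !card_deg_class big_tuple_cons.
  apply: eq_bigr => x _; rewrite (big_pred1 [tuple]) => [|u]; last first.
    by rewrite [u]tuple0 /= eqxx.
  by rewrite [[tuple of _]](_ : _ = [tuple of nseq 1 x])
             ?deg_sierpinski_nseq //; apply: val_inj.
rewrite card_deg_class_sierpinskiS IHt.
set D := k * _ - _.
have -> : \sum_(i < t.+1) #|G|%:Z ^+ i
          = 1 + #|G|%:Z * (\sum_(i < t) #|G|%:Z ^+ i).
  by rewrite big_ord_recl mulr_sumr; under eq_bigr do rewrite exprS.
by rewrite mulrDl mul1r -mulrA mulrBr mulrCA -exprS -addrA -opprD [D + _]addrC.
Qed.

Theorem theorem2p1 (G : sgraph) (t : nat) (k : int)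
  (hn : (2 <= #|G|)%N) (ht : (1 <= t)%N)
  (hmin : (min_deg (sierpinski G t))%:Z <= k)
  (hmax : k <= (max_deg (sierpinski G t))%:Z) :
  #|deg_class (sierpinski G t) k|%:R =
    #|deg_class G k|%:R * #|G|%:R ^+ t.-1
    - (#|G|%:R ^+ t.-1 - 1) / (#|G|%:R - 1)
      * (k%:~R * #|deg_class G k|%:R
         - (k - 1)%:~R * #|deg_class G (k - 1)|%:R) :> rat.
Proof.
case: t ht {hmin hmax} => // t _.
have n_neq1 : #|G|%:R - 1 != 0 :> rat.
  by rewrite subr_eq0 (eqr_nat _ _ 1) gtn_eqF.
rewrite subrX1 [_ * \sum_(_ < _) _]mulrC mulfK //=.
have := congr1 (intr : int -> rat) (card_deg_class_sierpinski G t k).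
rewrite !(rmorphB, rmorphM, rmorphXn, rmorph_sum) /= -!pmulrn => ->.
by congr (_ - _ * _); apply: eq_bigr => i _; rewrite rmorphXn.
Qed.
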